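(* Let $\mathcal{AK}(1)$ be the conformal Lie antialgebra with basis $\{\varepsilon_n\ (n\in\mathbb{Z}),\ a_i\ (i\in\mathbb{Z}+\frac12)\}$ and let $\{\varepsilon_n^*,a_i^*\}$ be the dual basis elements in $\mathcal{AK}(1)^*$. The linear map $\gamma:\mathcal{AK}(1)\to\mathcal{AK}(1)^*$ given by $$\gamma(\varepsilon_n)=-n\,\varepsilon_{-n}^*,\qquad \gamma(a_i)=\left(i^2-\tfrac14\right)a_{-i}^*,$$ is a non-trivial 1-cocycle on $\mathcal{AK}(1)$ (with coefficients in $\mathcal{AK}(1)^*$).
   Context: Vector spaces are over a field $\mathbb{K}$ of characteristic $0$. $\mathcal{AK}(1)$ is the $\mathbb{Z}_2$-graded commutative algebra (i.e. $a\cdot b=(-1)^{\bar a\bar b}b\cdot a$) with even basis elements $\varepsilon_n$ ($n\in\mathbb{Z}$), odd basis elements $a_i$ ($i\in\mathbb{Z}+\frac12$) and relations $\varepsilon_n\cdot\varepsilon_m=\varepsilon_{n+m}$, $\varepsilon_n\cdot a_i=\frac12a_{n+i}$, $a_i\cdot a_j=\frac12(j-i)\varepsilon_{i+j}$. For $\mathfrak{a}=\mathcal{AK}(1)$, the dual space $\mathfrak{a}^*$ (graded by $\mathfrak{a}^*_i=(\mathfrak{a}_i)^*$) carries the action $\langle a\cdot u,b\rangle:=(-1)^{\bar u\bar a}\langle u,a\cdot b\rangle$ for $u\in\mathfrak{a}^*$, $a,b\in\mathfrak{a}$, and one sets $u\cdot a=(-1)^{\bar a\bar u}a\cdot u$.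 The dual basis elements satisfy $\langle\varepsilon_n^*,\varepsilon_m\rangle=\delta_{n,m}$, $\langle a_i^*,a_j\rangle=\delta_{i,j}$, and all other pairings vanish. Cohomology of a Lie antialgebra $\mathfrak{a}$ with coefficients in $\mathcal{B}$ (here $\mathcal{B}=\mathfrak{a}^*$): for $p+q\ge1$, $C^{p,q}(\mathfrak{a};\mathcal{B})$ is the space of multilinear maps $\varphi:\mathfrak{a}_0^{\times p}\times\mathfrak{a}_1^{\times q}\to\mathcal{B}$, skew-symmetric in the $\mathfrak{a}_1$-variables, with values in $\mathcal{B}_0$ if $q$ is even and in $\mathcal{B}_1$ if $q$ is odd; $C^k=\bigoplus_{p+q=k}C^{p,q}$, $k\ge1$. On $\mathfrak{a}\oplus\mathcal{B}$, with product $(a,b)\cdot(a',b')=(a\cdot a',\,a\cdot b'+b\cdot a')$, put $m(u,v)=\frac12u\cdot v$ if $u,v$ are both even and $m(u,v)=u\cdot v$ if $(u,v)$ is (even, odd) or (odd, odd). The differential $\delta=\delta_{1,0}+\delta_{0,1}+\delta_{-1,2}:C^k\to C^{k+1}$, $\delta_{i,j}:C^{p,q}\to C^{p+i,q+j}$, is given for $\varphi\in C^{p,q}$ by: $\bullet$ $q=0$: $(\delta_{1,0}\varphi)(x_0,\ldots,x_p)=-m(x_0,\varphi(x_1,\ldots,x_p))+\sum_{i=0}^{p-1}(-1)^i\varphi(x_0,\ldots,m(x_i,x_{i+1}),\ldots,x_p)+(-1)^pm(\varphi(x_0,\ldots,x_{p-1}),x_p)$; $\bullet$ $q>0$: $(\delta_{1,0}\varphi)(x_0,\ldots,x_p;y_0,\ldots,y_{q-1})=-m(x_0,\varphi(x_1,\ldots,x_p;y_0,\ldots,y_{q-1}))+\sum_{i=0}^{p-1}(-1)^i\varphi(x_0,\ldots,m(x_i,x_{i+1}),\ldots,x_p;y_0,\ldots,y_{q-1})+\frac1q\sum_{j=0}^{q-1}(-1)^{p+j}\varphi(x_0,\ldots,x_{p-1};m(x_p,y_j),y_0,\ldots,\widehat{y_j},\ldots,y_{q-1})$;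 $\bullet$ $(\delta_{0,1}\varphi)(x_0,\ldots,x_{p-1};y_0,\ldots,y_q)=\frac{\kappa}{q+1}\sum_{j=0}^q(-1)^{p+j}m(\varphi(x_0,\ldots,x_{p-1};y_0,\ldots,\widehat{y_j},\ldots,y_q),y_j)$, with $\kappa=2$ if $p=0$ and $q$ is odd, and $\kappa=1$ otherwise; $\bullet$ $(\delta_{-1,2}\varphi)(x_0,\ldots,x_{p-2};y_0,\ldots,y_{q+1})=\frac{2}{(q+1)(q+2)}\sum_{i<j}(-1)^{p+i+j}\varphi(x_0,\ldots,x_{p-2},m(y_i,y_j);y_0,\ldots,\widehat{y_i},\ldots,\widehat{y_j},\ldots,y_{q+1})$ if $p>0$, and $\delta_{-1,2}\varphi=0$ if $p=0$. A parity preserving linear map $\mathfrak{a}\to\mathcal{B}$ is an element of $C^1=C^{1,0}\oplus C^{0,1}$. A 1-cocycle is an element of $\ker(\delta:C^1\to C^2)$; since cochains have $p+q\ge1$, the space of 1-coboundaries is zero. A cocycle is non-trivial if it is not a coboundary. *)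

(* Defs.v *)
(* The classical axioms of mathcomp.classical.boolp are used only to equip a
   dual space, a set of functions, with its lmodType structure. *)
From HB Require Import structures.
From mathcomp Require Import all_boot all_order all_algebra all_fingroup.
From mathcomp Require Import finmap boolp functions.
From mathcomp.multinomials Require Import monalg.

Set Implicit Arguments.
Unset Strict Implicit.
Unset Printing Implicit Defensive.

Import GRing.Theory.
Local Open Scope ring_scope.

(** * Z_2-graded spaces, algebras and modules *)

(* V false is the even part and V true the odd part; parities add up by (+). *)
Notation grspace K := (bool -> lmodType K).

Definition grcast (K : fieldType) (V : grspace K) (s t : bool) (e : s = t) :
    V s -> V t :=
  fun v => ecast r (V r) e v.

Lemma grcast_is_linear (K : fieldType) (V : grspace K) (s t : bool)
  (e : s = t) : linear (@grcast K V s t e).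
Proof. by case: t / e. Qed.

HB.instance Definition _ (K : fieldType) (V : grspace K) (s t : bool)
    (e : s = t) :=
  GRing.isLinear.Build K (V s) (V t) *:%R (@grcast K V s t e)
    (@grcast_is_linear K V s t e).

Lemma grcast_id (K : fieldType) (V : grspace K) (s : bool) (e : s = s)
  (v : V s) : grcast e v = v.
Proof. by rewrite /grcast eq_axiomK. Qed.

(* The structures below only record the data entering the formulas for the
   differential: neither commutativity nor the remaining axioms of Lie
   antialgebras are imposed on them. *)
Record gralg (K : fieldType) := GrAlg {
  alg_part :> grspace K;
  grmul : forall s t, alg_part s -> alg_part t -> alg_part (s (+) t);
  grmul_linearr : forall s t (u : alg_part s), linear (@grmul s t u);
  grmul_linearl : forall s t (v : alg_part t),
    linear (fun u : alg_part s => grmul u v)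
}.

HB.instance Definition _ (K : fieldType) (A : gralg K) (s t : bool) (u : A s) :=
  GRing.isLinear.Build K (A t) (A (s (+) t)) *:%R (@grmul K A s t u)
    (@grmul_linearr K A s t u).

Record grmod (K : fieldType) (A : gralg K) := GrMod {
  mod_part :> grspace K;
  lact : forall s t, A s -> mod_part t -> mod_part (s (+) t);
  lact_linearr : forall s t (a : A s), linear (@lact s t a);
  lact_linearl : forall s t (u : mod_part t),
    linear (fun a : A s => lact a u)
}.

(* u . a = (-1)^(|a||u|) a . u *)
Definition ract (K : fieldType) (A : gralg K) (B : grmod A) (s t : bool)
    (u : B s) (a : A t) : B (s (+) t) :=
  grcast (addbC t s) ((-1) ^+ (s && t) *: lact a u).

Lemma ract_linearr (K : fieldType) (A : gralg K) (B : grmod A) (s t : bool)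
  (u : B s) : linear (fun a : A t => ract u a).
Proof.
move=> c a b; rewrite /ract (lact_linearl u c a b) scalerDr scalerA mulrC.
by rewrite -scalerA linearP.
Qed.

Lemma ract_linearl (K : fieldType) (A : gralg K) (B : grmod A) (s t : bool)
  (a : A t) : linear (fun u : B s => ract u a).
Proof.
move=> c u v; rewrite /ract (lact_linearr a c u v) scalerDr scalerA mulrC.
by rewrite -scalerA linearP.
Qed.

(* The algebra a (+) B, with product (a,b).(a',b') = (a.a', a.b' + b.a'). *)
Definition sd_part (K : fieldType) (A : gralg K) (B : grmod A) : grspace K :=
  fun s => (A s * B s)%type.

Definition sd_mul (K : fieldType) (A : gralg K) (B : grmod A) (s t : bool)
    (u : sd_part B s) (v : sd_part B t) : sd_part B (s (+) t) :=
  (grmul u.1 v.1, lact u.1 v.2 + ract u.2 v.1).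

Lemma sd_mul_linearr (K : fieldType) (A : gralg K) (B : grmod A) (s t : bool)
  (u : sd_part B s) : linear (@sd_mul K A B s t u).
Proof.
move=> c v w; congr pair; first exact: grmul_linearr.
rewrite /= (lact_linearr u.1 c v.2 w.2) (ract_linearr u.2 c v.1 w.1).
by rewrite scalerDr addrACA.
Qed.

Lemma sd_mul_linearl (K : fieldType) (A : gralg K) (B : grmod A) (s t : bool)
  (v : sd_part B t) : linear (fun u : sd_part B s => sd_mul u v).
Proof.
move=> c u w; congr pair; first exact: (grmul_linearl v.1 c u.1 w.1).
rewrite /= (lact_linearl v.2 c u.1 w.1) (ract_linearl v.1 c u.2 w.2).
by rewrite scalerDr addrACA.
Qed.

Definition sdalg (K : fieldType) (A : gralg K) (B : grmod A) : gralg K :=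
  GrAlg (@sd_mul_linearr K A B) (@sd_mul_linearl K A B).

(* m(u,v) = 1/2 u.v for u, v even, and u.v for (even, odd) and (odd, odd).
   The value on a pair (odd, even) is immaterial: the differential never
   evaluates m on such a pair. *)
Definition mprod (K : fieldType) (A : gralg K) (s t : bool) (u : A s) (v : A t) :
    A (s (+) t) :=
  (if s || t then 1 else 2^-1) *: grmul u v.

(* The restrictions of the operation m of a (+) B to a x B and B x a. *)
Definition mAB (K : fieldType) (A : gralg K) (B : grmod A) (s t : bool)
    (a : A s) (b : B t) : B (s (+) t) :=
  (mprod ((a, 0) : sdalg B s) ((0, b) : sdalg B t)).2.

Definition mBA (K : fieldType) (A : gralg K) (B : grmod A) (s t : bool)
    (b : B s) (a : A t) : B (s (+) t) :=
  (mprod ((0, b) : sdalg B s) ((a, 0) : sdalg B t)).2.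

(** * Cochains and the differential *)

Section Cohomology.
Context {K : fieldType} {A : gralg K} (B : grmod A).

(* All maps a_0^p x a_1^q -> B_(q mod 2); the arguments are the families
   x_0, ..., x_(p-1) and y_0, ..., y_(q-1). *)
Definition precochain (p q : nat) : Type :=
  ('I_p -> A false) -> ('I_q -> A true) -> B (odd q).

(* Membership in C^{p,q}: multilinear, skew-symmetric in the odd variables. *)
Definition is_Cpq (p q : nat) (f : precochain p q) : Prop :=
  [/\ forall x y (i : 'I_p), linear (fun v => f (@dfwith _ _ x i v) y),
      forall x y (j : 'I_q), linear (fun v => f x (@dfwith _ _ y j v)) &
      forall x y (s : 'S_q), f x (y \o s) = (-1) ^+ s *: f x y].

(* An element of C^k is a family of cochains whose components of bidegree
   (p,q) vanish unless p + q = k.  There are no cochains of bidegree (0,0),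
   hence C^0 = 0. *)
Definition precochains : Type := forall p q, precochain p q.

Definition is_Ck (k : nat) (f : precochains) : Prop :=
  forall p q, is_Cpq (f p q) /\
    (~~ ((p + q == k)%N && (0 < p + q)%N) -> forall x y, f p q x y = 0).

Section Families.
Context {T : Type}.

(* x_1, ..., x_n and x_0, ..., x_(n-1) out of x_0, ..., x_n *)
Definition behead_fam n (x : 'I_n.+1 -> T) : 'I_n -> T :=
  fun k => x (lift ord0 k).
Definition belast_fam n (x : 'I_n.+1 -> T) : 'I_n -> T :=
  fun k => x (lift ord_max k).
(* the family y with y_j omitted *)
Definition omit_fam n (y : 'I_n.+1 -> T) (j : 'I_n.+1) : 'I_n -> T :=
  fun k => y (lift j k).
Definition cons_fam n (v : T) (x : 'I_n -> T) : 'I_n.+1 -> T :=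
  fun k => oapp x v (unlift ord0 k).
Definition rcons_fam n (x : 'I_n -> T) (v : T) : 'I_n.+1 -> T :=
  fun k => oapp x v (unlift ord_max k).
(* x_0, ..., op x_i x_(i+1), ..., x_n *)
Definition merge_fam (op : T -> T -> T) n (x : 'I_n.+1 -> T) (i : 'I_n) :
    'I_n -> T :=
  fun k => if (k < i)%N then x (lift ord_max k)
           else if k == i then op (x (lift ord_max i)) (x (lift ord0 i))
           else x (lift ord0 k).

End Families.

Definition delta10 (p q : nat) : precochain p q -> precochain p.+1 q :=
  match q return precochain p q -> precochain p.+1 q with
  | 0 => fun f x y =>
      - mAB (x ord0) (f (behead_fam x) y)
      + \sum_(i < p)
          (-1) ^+ i *: f (merge_fam (@mprod K A false false) x i) y
      + (-1) ^+ p *: mBA (f (belast_fam x) y) (x ord_max)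
  | q'.+1 => fun f x y =>
      - mAB (x ord0) (f (behead_fam x) y)
      + \sum_(i < p)
          (-1) ^+ i *: f (merge_fam (@mprod K A false false) x i) y
      + q'.+1%:R^-1 *: \sum_(j < q'.+1) (-1) ^+ (p + j) *:
          f (belast_fam x) (cons_fam (mprod (x ord_max) (y j)) (omit_fam y j))
  end.

Definition delta01 (p q : nat) (f : precochain p q) : precochain p q.+1 :=
  fun x y =>
    ((if (p == 0)%N && odd q then 2 else 1) / q.+1%:R) *:
      \sum_(j < q.+1) (-1) ^+ (p + j) *:
        grcast (addbT (odd q)) (mBA (f x (omit_fam y j)) (y j)).

(* For i < j the index i of 'I_q.+1 stands for lift j i of 'I_q.+2, which has
   the same value; omitting y_j and then index i removes y_i and y_j. *)
Definition delta_12 (p q : nat) (f : precochain p.+1 q) : precochain p q.+2 :=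
  fun x y =>
    (2 / (q.+1 * q.+2)%:R) *:
      \sum_(j < q.+2) \sum_(i < q.+1 | (i < j)%N) (-1) ^+ (p.+1 + i + j) *:
        grcast (esym (negbK (odd q)))
          (f (rcons_fam x (mprod (y (lift j i)) (y j)))
             (omit_fam (omit_fam y j) i)).

(* The component of bidegree (p,q) of delta f collects the contributions of
   the components (p-1,q), (p,q-1) and (p+1,q-2) of f. *)
Definition delta (f : precochains) : precochains := fun p q x y =>
  match p return ('I_p -> A false) -> B (odd q) with
  | 0 => fun=> 0
  | p'.+1 => fun x => delta10 (f p' q) x y
  end x
  + match q return ('I_q -> A true) -> B (odd q) with
    | 0 => fun=> 0
    | q'.+1 => fun y => delta01 (f p q') x y
    end y
  + match q return ('I_q -> A true) -> B (odd q) with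
    | q'.+2 => fun y => delta_12 (f p.+1 q') x y
    | _ => fun=> 0
    end y.

Arguments delta f p q x y : clear implicits.

Definition is_cocycle (k : nat) (f : precochains) : Prop :=
  is_Ck k f /\ forall p q x y, delta f p q x y = 0.

(* For k = 1 the only candidate is g = 0, since C^0 = 0. *)
Definition is_coboundary (k : nat) (f : precochains) : Prop :=
  exists g, is_Ck k.-1 g /\ forall p q x y, f p q x y = delta g p q x y.

(* The element of C^1 = C^{1,0} (+) C^{0,1} given by a parity preserving
   linear map a -> B. *)
Definition cochain1 (c : forall s, {linear A s -> B s}) : precochains :=
  fun p q => match p, q return precochain p q with
  | 1, 0 => fun x _ => c false (x ord0)
  | 0, 1 => fun _ y => c true (y ord0)
  | _, _ => fun _ _ => 0
  end.

End Cohomology.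

Arguments delta {K A B} f p q x y.

(** * Dual spaces *)

Definition linform {K : fieldType} {V : lmodType K} : {pred V -> K^o} :=
  [pred f : V -> K^o | `[< linear f >]].

Lemma linform_submod_closed (K : fieldType) (V : lmodType K) :
  submod_closed (@linform K V).
Proof.
split=> [|c f g /asboolP lf /asboolP lg]; apply/asboolP => d u v.
  by rewrite scaler0 addr0.
have E h x : (c *: f + h) x = c *: f x + h x by [].
by rewrite !E lf lg !scalerDr !scalerA mulrC addrACA.
Qed.

HB.instance Definition _ (K : fieldType) (V : lmodType K) :=
  GRing.isSubmodClosed.Build K (V -> K^o) (@linform K V)
    (linform_submod_closed V).

Record dual (K : fieldType) (V : lmodType K) :=
  Dual { pairing :> V -> K^o; pairing_linform : pairing \in linform }.

HB.instance Definition _ (K : fieldType) (V : lmodType K) :=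
  [isSub for @pairing K V].
HB.instance Definition _ (K : fieldType) (V : lmodType K) :=
  [Choice of dual V by <:].
HB.instance Definition _ (K : fieldType) (V : lmodType K) :=
  [SubChoice_isSubLmodule of dual V by <:].

Lemma pairing_is_linear (K : fieldType) (V : lmodType K) (u : dual V) :
  linear (u : V -> K^o).
Proof. exact/asboolP/pairing_linform. Qed.

HB.instance Definition _ (K : fieldType) (V : lmodType K) (u : dual V) :=
  GRing.isLinear.Build K V K^o *:%R (pairing u) (@pairing_is_linear K V u).

Lemma linear_linform (K : fieldType) (V : lmodType K)
  (f : {linear V -> K^o}) : (f : V -> K^o) \in linform.
Proof. by apply/asboolP => c u v; rewrite linearP. Qed.

Definition mkdual (K : fieldType) (V : lmodType K) (f : {linear V -> K^o}) :
    dual V :=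
  Dual (linear_linform f).

Lemma dual_ext (K : fieldType) (V : lmodType K) (u v : dual V) :
  (forall b, u b = v b) -> u = v.
Proof. by move=> uv; apply/val_inj/funext. Qed.

Lemma dualDE (K : fieldType) (V : lmodType K) (u v : dual V) b :
  (u + v) b = u b + v b.
Proof. by []. Qed.

Lemma dualZE (K : fieldType) (V : lmodType K) (c : K) (u : dual V) b :
  (c *: u) b = c *: u b.
Proof. by []. Qed.

Section DualModule.
Context {K : fieldType} (A : gralg K).

Definition dual_part : grspace K := fun s => dual (A s).

(* < a . u, b > = (-1)^(|u||a|) < u, a . b > *)
Definition dual_act_fun (s t : bool) (a : A s) (u : dual_part t)
    (b : A (s (+) t)) : K^o :=
  (-1) ^+ (t && s) *: (u : dual (A t)) (grcast (addKb s t) (grmul a b)).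

Lemma dual_act_fun_is_linear (s t : bool) (a : A s) (u : dual_part t) :
  linear (dual_act_fun a u).
Proof.
by move=> c b b'; rewrite /dual_act_fun !linearP /= scalerA mulrC -scalerA.
Qed.

HB.instance Definition _ (s t : bool) (a : A s) (u : dual_part t) :=
  GRing.isLinear.Build K (A (s (+) t)) K^o *:%R (dual_act_fun a u)
    (dual_act_fun_is_linear a u).

Definition dual_act (s t : bool) (a : A s) (u : dual_part t) :
    dual_part (s (+) t) :=
  mkdual (dual_act_fun a u).

Lemma dual_act_linearr (s t : bool) (a : A s) : linear (@dual_act s t a).
Proof.
move=> c u v; apply: dual_ext => b; rewrite dualDE dualZE /= /dual_act_fun.
by rewrite dualDE dualZE scalerDr !scalerA mulrC.
Qed.

Lemma dual_act_linearl (s t : bool) (u : dual_part t) :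
  linear (fun a : A s => dual_act a u).
Proof.
move=> c a a'; apply: dual_ext => b; rewrite dualDE dualZE /= /dual_act_fun.
by rewrite (grmul_linearl b c a a') !linearP /= scalerA mulrC -scalerA.
Qed.

Definition dualmod : grmod A := GrMod dual_act_linearr dual_act_linearl.

End DualModule.

(** * The conformal Lie antialgebra AK(1) *)

Section LinearExtension.
Context {K : fieldType} {I : choiceType} {V : lmodType K}.

(* The linear map on the space with basis I sending the basis vector i to
   f i. *)
Definition lext (f : I -> V) (x : {malg K[I]}) : V :=
  \sum_(i <- msupp x) x@_i *: f i.

Lemma lextEw (f : I -> V) (d : {fset I}) (x : {malg K[I]}) :
  (msupp x `<=` d)%fset -> lext f x = \sum_(i <- d) x@_i *: f i.
Proof.
move=> xd; rewrite /lext (big_fset_incl _ xd) // => i _ /mcoeff_outdom ->.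
by rewrite scale0r.
Qed.

Lemma lext_is_linear (f : I -> V) : linear (lext f).
Proof.
move=> c x y; pose d := (msupp x `|` msupp y `|` msupp (c *: x + y))%fset.
rewrite !(@lextEw f d) ?fsubsetUr //; last first.
- by rewrite /d -fsetUA fsubsetUl.
- by rewrite /d fsubsetU // fsubsetUr.
rewrite scaler_sumr -big_split; apply: eq_bigr => i _.
by rewrite mcoeffD mcoeffZ scalerDl scalerA.
Qed.

HB.instance Definition _ (f : I -> V) :=
  GRing.isLinear.Build K {malg K[I]} V *:%R (lext f) (lext_is_linear f).

Lemma lextU (f : I -> V) (i : I) : lext f << i >> = f i.
Proof.
rewrite (@lextEw f [fset i]%fset) ?msuppU_le // big_seq_fset1.
by rewrite mcoeffU eqxx scale1r.
Qed.

Lemma eq_lext (f g : I -> V) (x : {malg K[I]}) :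
  (forall i, f i = g i) -> lext f x = lext g x.
Proof. by move=> fg; apply: eq_bigr => i _; rewrite fg. Qed.

End LinearExtension.

Lemma linear_lext (K : fieldType) (I : choiceType) (V W : lmodType K)
  (h : {linear V -> W}) (f : I -> V) (x : {malg K[I]}) :
  h (lext f x) = lext (fun i => h (f i)) x.
Proof. by rewrite linear_sum; apply: eq_bigr => i _; rewrite linearZ. Qed.

Lemma lext_exchange (K : fieldType) (I J : choiceType) (V : lmodType K)
  (f : I -> J -> V) (x : {malg K[I]}) (y : {malg K[J]}) :
  lext (fun i => lext (f i) y) x = lext (fun j => lext (f^~ j) x) y.
Proof.
rewrite /lext; under eq_bigr do rewrite scaler_sumr.
rewrite exchange_big; apply: eq_bigr => j _; rewrite scaler_sumr.
by apply: eq_bigr => i _; rewrite !scalerA mulrC.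
Qed.

(* HalfInt k is the half-integer k + 1/2; hval is its value in R. *)
Record halfint := HalfInt { hfloor : int }.
HB.instance Definition _ := [isNew for hfloor].
HB.instance Definition _ := [Choice of halfint by <:].

Definition hval {R : unitRingType} (i : halfint) : R := (hfloor i)%:~R + 2^-1.
Definition haddz (n : int) (i : halfint) : halfint := HalfInt (n + hfloor i).
Definition hadd (i j : halfint) : int := hfloor i + hfloor j + 1.
Definition hopp (i : halfint) : halfint := HalfInt (- hfloor i - 1).

Lemma hval_haddz n i : hval (haddz n i) = n%:~R + hval i :> rat.
Proof. by rewrite /hval rmorphD addrA. Qed.

Lemma hval_hadd i j : (hadd i j)%:~R = hval i + hval j :> rat.
Proof. by rewrite /hval !rmorphD addrACA. Qed.

Lemma hval_hopp i : hval (hopp i) = - hval i :> rat.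
Proof. by rewrite /hval rmorphB rmorphN /= opprD -addrA. Qed.

Section AK1.
Context (K : fieldType).

Definition AK_index (s : bool) : choiceType :=
  if s then (halfint : choiceType) else (int : choiceType).

Definition AK_part : grspace K := fun s => ({malg K[AK_index s]} : lmodType K).

(* The basis elements epsilon_n and a_i. *)
Definition eps (n : int) : AK_part false := << (n : AK_index false) >>.
Definition aa (i : halfint) : AK_part true := << (i : AK_index true) >>.

Definition AK_basis_mul (s t : bool) :
    AK_index s -> AK_index t -> AK_part (s (+) t) :=
  match s, t return AK_index s -> AK_index t -> AK_part (s (+) t) with
  | false, false => fun n n' => eps (n + n')
  | false, true => fun n i => 2^-1 *: aa (haddz n i)
  | true, false => fun i n => 2^-1 *: aa (haddz n i)
  | true, true => fun i j => (2^-1 * (hval j - hval i)) *: eps (hadd i j)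
  end.

Definition AK_mul (s t : bool) (u : AK_part s) (v : AK_part t) :
    AK_part (s (+) t) :=
  lext (fun i => lext (fun j => AK_basis_mul i j) v) u.

Lemma AK_mul_linearl (s t : bool) (v : AK_part t) :
  linear (fun u : AK_part s => AK_mul u v).
Proof. exact: lext_is_linear. Qed.

Lemma AK_mul_linearr (s t : bool) (u : AK_part s) : linear (@AK_mul s t u).
Proof.
move=> c v w; rewrite /AK_mul /lext scaler_sumr -big_split /=.
apply: eq_bigr => i _; rewrite scalerA mulrC -scalerA -scalerDr.
by congr (_ *: _); apply: lext_is_linear.
Qed.

Definition AK : gralg K := GrAlg AK_mul_linearr AK_mul_linearl.

Lemma AK_basis_mulC (s t : bool) (i : AK_index s) (j : AK_index t) :
  AK_basis_mul i j =
    grcast (addbC t s) ((-1) ^+ (s && t) *: AK_basis_mul j i).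
Proof.
case: s t i j => [] [] i j; rewrite grcast_id ?scale1r //=.
  by rewrite scalerA expr1 mulN1r -mulrN opprB /hadd (addrC (hfloor j)).
by rewrite addrC.
Qed.

Lemma AK_mulC (s t : bool) (u : AK s) (v : AK t) :
  grmul u v = grcast (addbC t s) ((-1) ^+ (s && t) *: grmul v u).
Proof.
pose c : {linear AK_part (t (+) s) -> AK_part (s (+) t)} :=
  (-1) ^+ (s && t) \*: grcast (addbC t s).
transitivity (c (grmul v u)); last by rewrite /= linearZ.
etransitivity; first exact: lext_exchange.
rewrite [RHS](linear_lext c); apply: eq_lext => j.
rewrite [RHS](linear_lext c); apply: eq_lext => i.
by rewrite AK_basis_mulC /= linearZ.
Qed.

Definition AK_dual : grmod AK := dualmod AK.

Definition eps_dual (n : int) : AK_dual false :=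
  mkdual (lext (fun k : AK_index false => (k == n)%:R : K^o)).
Definition aa_dual (i : halfint) : AK_dual true :=
  mkdual (lext (fun k : AK_index true => (k == i)%:R : K^o)).

Definition gamma_basis (s : bool) : AK_index s -> AK_dual s :=
  match s return AK_index s -> AK_dual s with
  | false => fun n => - (n : int)%:~R *: eps_dual (- (n : int))
  | true => fun i => (hval i ^+ 2 - 4^-1) *: aa_dual (hopp i)
  end.

Definition gamma (s : bool) : {linear AK s -> AK_dual s} :=
  lext (@gamma_basis s).

End AK1.

(* Main.v *)
(* Since C^0 = 0, non-triviality only means that gamma is nonzero.  The three
   components of delta c for an element c of C^1, of bidegrees (2,0), (1,1) and
   (0,2), all vanish as soon as c(u v) = u c(v) + c(u) v for all homogeneous u
   and v.  For gamma this identity is checked on basis elements by pairing both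
   sides with a third basis element: all pairings vanish unless the three
   indices add up to 0, and then a polynomial identity in the indices
   remains. *)
From HB Require Import structures.
Require Import Defs.
From mathcomp Require Import all_boot all_algebra fingroup perm.
From mathcomp Require Import ring.
From mathcomp.multinomials Require Import monalg.

Set Implicit Arguments.
Unset Strict Implicit.
Unset Printing Implicit Defensive.

Import GRing.Theory.
Local Open Scope ring_scope.

Lemma linear_fun0 (K : fieldType) (U V : lmodType K) (f : U -> V) :
  linear f -> f 0 = 0.
Proof.
by move=> lf; have := lf (-1) 0 0; rewrite scaler0 addr0 scaleN1r addNr.
Qed.

Section Derivations.
Context {K : fieldType} {A : gralg K} (B : grmod A).

Lemma mABE s t (a : A s) (b : B t) :
  mAB a b = (if s || t then 1 else 2^-1) *: lact a b.
Proof.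
rewrite /mAB /mprod /=; congr (_ *: _).
by rewrite (linear_fun0 (ract_linearl (0 : A t))) addr0.
Qed.

Lemma mBAE s t (b : B s) (a : A t) :
  mBA b a = (if s || t then 1 else 2^-1) *: ract b a.
Proof.
rewrite /mBA /mprod /=; congr (_ *: _).
by rewrite (linear_fun0 (lact_linearr (0 : A s))) add0r.
Qed.

Lemma mAB0 s t (a : A s) : mAB a (0 : B t) = 0.
Proof. by rewrite mABE (linear_fun0 (lact_linearr a)) scaler0. Qed.

Lemma mBA0 s t (a : A t) : mBA (0 : B s) a = 0.
Proof. by rewrite mBAE (linear_fun0 (ract_linearl a)) scaler0. Qed.

Lemma delta10_0 p q (f : precochain B p q) x y :
  (forall x y, f x y = 0) -> delta10 f x y = 0.
Proof.
case: q f y => [|q] f y f0 /=; rewrite ?f0 mAB0 ?mBA0 ?scaler0 ?oppr0 ?add0r.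
  by rewrite addr0 big1 // => i _; rewrite f0 scaler0.
by rewrite !big1 ?scaler0 ?addr0 // => i _; rewrite f0 scaler0.
Qed.

Lemma delta01_0 p q (f : precochain B p q) x y :
  (forall x y, f x y = 0) -> delta01 f x y = 0.
Proof.
move=> f0; rewrite /delta01 big1 ?scaler0 // => j _.
by rewrite f0 mBA0 linear0 scaler0.
Qed.

Lemma delta_12_0 p q (f : precochain B p.+1 q) x y :
  (forall x y, f x y = 0) -> delta_12 f x y = 0.
Proof.
move=> f0; rewrite /delta_12 big1 ?scaler0 // => j _; rewrite big1 // => i _.
by rewrite f0 linear0 scaler0.
Qed.

Lemma delta0 (f : precochains B) p q x y :
  (forall p q x y, f p q x y = 0) -> delta f p q x y = 0.
Proof.
move=> f0; rewrite /delta.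
case: p x => [|p] x; case: q y => [|[|q]] y;
  by rewrite ?delta10_0 ?delta01_0 ?delta_12_0 ?addr0.
Qed.

(** No bidegree satisfies both [p + q == 0] and [0 < p + q], so a cochain of degree 0 vanishes
    identically, and so does its [delta]. *)
Lemma coboundary1_eq0 (f : precochains B) :
  is_coboundary 1 f -> forall p q x y, f p q x y = 0.
Proof.
case=> g [gC fE] p q x y; rewrite fE; apply: delta0 => {}p {}q {}x {}y.
by apply: (gC p q).2; case: (p + q)%N.
Qed.

Lemma is_Cpq0 p q : is_Cpq (fun _ _ => 0 : B (odd q)) (p := p).
Proof.
by split=> *; rewrite ?scaler0 ?addr0 // => c u v; rewrite scaler0 addr0.
Qed.

Lemma dfwith_ord1 (T : Type) (x : 'I_1 -> T) (i : 'I_1) v :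
  @dfwith _ _ x i v ord0 = v.
Proof. by rewrite [i]ord1 dfwith_in. Qed.

(** With at most one odd variable, skew-symmetry only concerns the identity permutation. *)
Lemma cochain1_is_C1 (c : forall s, {linear A s -> B s}) :
  is_Ck 1 (cochain1 c).
Proof.
move=> p q; split; last by case: p q => [|[|p]] [|[|q]].
case: p q => [|[|p]] [|[|q]]; try exact: is_Cpq0; split => /=.
- by move=> x y [].
- by move=> x y i a u v; rewrite !dfwith_ord1 linearP.
- move=> x y s; have -> : s = 1%g.
    by apply/permP => i; rewrite [LHS]ord1 [RHS]ord1.
  by rewrite odd_perm1 scale1r perm1.
- by move=> x y i a u v; rewrite !dfwith_ord1 linearP.
- by move=> x y [].
- move=> x y s; have -> : s = 1%g by apply/permP => -[].
  by rewrite odd_perm1 scale1r.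
Qed.

(** No sign occurs because [c] preserves parity. *)
Definition is_derivation (c : forall s, {linear A s -> B s}) :=
  forall s t (u : A s) (v : A t),
    c _ (grmul u v) = lact u (c t v) + ract (c s u) v.

Lemma derivation_cocycle (c : forall s, {linear A s -> B s}) :
  (2 : K) != 0 -> is_derivation c -> is_cocycle 1 (cochain1 c).
Proof.
move=> nz2 dc; split=> [|p q x y]; first exact: cochain1_is_C1.
rewrite /delta; case: p x => [|[|[|p]]] x; case: q y => [|[|[|[|q]]]] y;
  rewrite ?(@delta10_0 _ _ (fun _ _ => 0)) ?(@delta01_0 _ _ (fun _ _ => 0))
    ?(@delta_12_0 _ _ (fun _ _ => 0)) ?addr0 ?add0r //.
(* Bidegree (0,2): both normalising factors are 2/2, hence the hypothesis on 2. What remains is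
   c(y_1).y_0 - c(y_0).y_1 + c(y_0.y_1), where c(y_1).y_0 = -y_0.c(y_1) by the definition of
   [ract]. *)
- have e10 : lift (lift ord0 ord0) ord0 = ord0 :> 'I_2 by apply/val_inj.
  have e01 : lift ord0 ord0 = ord_max :> 'I_2 by apply/val_inj.
  have e00 : unlift ord_max ord0 = None :> option 'I_0.
    by case: unliftP => // -[].
  rewrite /delta01 /delta_12 /= !big_ord_recl !big_ord0 !addr0 /=.
  rewrite big_mkcond big_ord_recl big_ord0 /=.
  rewrite big_mkcond big_ord_recl big_ord0 /=.
  rewrite divff // !scale1r !addr0 add0r /omit_fam /rcons_fam e10 e01 e00 /=.
  rewrite /mprod /= scale1r !grcast_id !mBAE /= !scale1r.
  rewrite (dc true true) /bump /= expr1 sqrrN expr1n scale1r scaleN1r.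
  rewrite /ract !grcast_id /= expr1 !scaleN1r opprK.
  by rewrite addrACA addNr add0r subrr.
(* Bidegree (1,1): the summands are -x.c(y), c(x.y) and -c(x).y. *)
- rewrite /delta10 /delta01 /= !big_ord_recl !big_ord0 /=.
  rewrite mABE mBAE /mprod /= !grcast_id invr1 mulr1 !scale1r !addr0.
  rewrite scaleN1r /cons_fam unlift_none [ord_max]ord1 /= (dc false true).
  by rewrite addrA addNr add0r subrr.
(* Bidegree (2,0): all three terms carry the factor 1/2 of [mprod], which linearity pulls out of
   [c]. *)
- rewrite /delta10 /= !big_ord_recl !big_ord0 /=.
  rewrite mABE mBAE /mprod /merge_fam /belast_fam /behead_fam /=.
  have c_mul (u v : A false) : c false (2^-1 *: grmul u v)
      = 2^-1 *: (lact u (c false v) + ract (c false u) v).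
    by rewrite linearZ (dc false false).
  have e10 : lift ord_max ord0 = ord0 :> 'I_2 by apply/val_inj.
  have e01 : lift ord0 ord0 = ord_max :> 'I_2 by apply/val_inj.
  rewrite c_mul e10 e01 scale1r addr0 expr1 scaleN1r scalerDr.
  by rewrite addrA addNr add0r subrr.
Qed.

End Derivations.

Section Gamma.
Context (K : fieldType).

(** Taking plain functions with proofs of linearity lets this apply to both sides of an identity,
    viewed as functions of one chosen argument. *)
Lemma malg_linear_ext (I : choiceType) (V : lmodType K)
    (f g : {malg K[I]} -> V) :
  linear f -> linear g -> (forall i, f << i >> = g << i >>) -> f =1 g.
Proof.
move=> lf lg fg x.
pose F := HB.pack_for {linear {malg K[I]} -> V} f
  (GRing.isLinear.Build K {malg K[I]} V *:%R f lf).
pose G := HB.pack_for {linear {malg K[I]} -> V} g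
  (GRing.isLinear.Build K {malg K[I]} V *:%R g lg).
have xE : x = lext (fun i => << i >>) x.
  rewrite [LHS]monalgE; apply: eq_bigr => i _.
  by apply/malgP => k; rewrite mcoeffZ !mcoeffU mulr_natr.
rewrite xE -[f]/(F : _ -> _) -[g]/(G : _ -> _) !linear_lext.
exact: eq_lext.
Qed.

Lemma gamma_epsE n : gamma K false (eps K n) = - n%:~R *: eps_dual K (- n).
Proof. exact: (lextU (@gamma_basis K false)). Qed.

Lemma gamma_aaE i :
  gamma K true (aa K i) = (hval i ^+ 2 - 4^-1) *: aa_dual K (hopp i).
Proof. exact: (lextU (@gamma_basis K true)). Qed.

(** The condition is put as the vanishing of an index sum, so that the three terms of the derivation
    identity end up with the same one. *)
Lemma gamma_eps_pairing n k :
  (gamma K false (eps K n) : dual _) (eps K k) = - n%:~R * (n + k == 0)%:R.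
Proof.
rewrite gamma_epsE dualZE /=; congr (_ * _).
by rewrite [LHS]lextU addrC addr_eq0.
Qed.

Lemma gamma_aa_pairing i k :
  (gamma K true (aa K i) : dual _) (aa K k)
    = (hval i ^+ 2 - 4^-1) * (hadd i k == 0)%:R.
Proof.
rewrite gamma_aaE dualZE /=; congr (_ * _).
rewrite [LHS]lextU -(inj_eq val_inj) /= /hadd -subr_eq0; congr (_ == _)%:R.
by rewrite !opprD !opprK addrCA addrA.
Qed.

Lemma AK_mulU s t (i : AK_index s) (j : AK_index t) :
  grmul (<< i >> : AK K s) (<< j >> : AK K t) = AK_basis_mul K i j.
Proof. by rewrite /= /AK_mul !lextU. Qed.

Lemma dual_lactE (A : gralg K) s t (a : A s) (u : dualmod A t)
    (b : A (s (+) t)) :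
  (lact a u : dual _) b
    = (-1) ^+ (t && s) * (u : dual _) (grcast (addKb s t) (grmul a b)).
Proof. by []. Qed.


Lemma gamma_derivation : [pchar K] =i pred0 -> is_derivation (gamma K).
Proof.
(* From here on only the linearity of [gamma] and its pairings on basis vectors are available. *)
move=> charK0; move: (gamma K) gamma_eps_pairing gamma_aa_pairing => g ge ga.
have gZl r c (w b : AK K r) :
  (g r (c *: w) : dual _) b = c * (g r w : dual _) b.
  by rewrite linearZ.
have gZr r c (w b : AK K r) :
  (g r w : dual _) (c *: b) = c * (g r w : dual _) b.
  exact: linearZ.
have [nz2 nz4] : (2 : K) != 0 /\ (4 : K) != 0.
  by split; rewrite ((pcharf0P K).1 charK0).
(* Both sides are trilinear in [u], [v] and [b], so basis vectors suffice. *)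
move=> s t u v; apply: dual_ext => b; move: b.
apply: malg_linear_ext; try exact: pairing_is_linear.
move=> k; move: v; apply: malg_linear_ext.
- by move=> c x y; rewrite (grmul_linearr u c (x : AK K t) y) linearP.
- move=> c x y; rewrite linearP (lact_linearr u c (g t x) (g t y)).
  by rewrite (ract_linearr _ c (x : AK K t) y) addrACA -scalerDr.
move=> j; move: u; apply: malg_linear_ext.
- by move=> c x y; rewrite (grmul_linearl _ c (x : AK K s) y) linearP.
- move=> c x y; rewrite linearP (lact_linearl _ c (x : AK K s) y).
  by rewrite (ract_linearl _ c (g s x) (g s y)) addrACA -scalerDr.
move=> i; rewrite AK_mulU dualDE.
case: s t i j k => [] [] i j k;
  rewrite /ract !grcast_id dualZE !dual_lactE !AK_mulU /= ?grcast_id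
    ?expr0 ?expr1.
(* Two odd factors: in terms of index values, 1/2 (j - i)(-(i + j)) = 1/2 (i^2 - 1/4) - 1/2 (j^2 -
   1/4). *)
- rewrite -[<< k >>]/(eps K k) -[<< i >>]/(aa K i) -[<< j >>]/(aa K j).
  rewrite !(gZl, gZr) ge !ga.
  case: i j => [i] [j]; rewrite /hval /hadd /haddz /= !rmorphD /=.
  have -> : j + (k + i) + 1 = i + j + 1 + k by ring.
  have -> : i + (k + j) + 1 = i + j + 1 + k by ring.
  case: eqVneq => _; last by rewrite !mulr0 scaler0 addr0.
  rewrite -[-1 *: _]/(-1 * _); by field; rewrite nz2 nz4.
- rewrite -[<< k >>]/(aa K k) -[<< i >>]/(aa K i) -[<< j >>]/(eps K j).
  rewrite !(gZl, gZr) ge !ga.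
  case: i k => [i] [k]; rewrite /hval /hadd /haddz /= !rmorphD /=.
  have -> : j + (i + k + 1) = j + i + k + 1 by ring.
  have -> : i + (j + k) + 1 = j + i + k + 1 by ring.
  case: eqVneq => [e0|_]; last by rewrite !mulr0 scaler0 addr0.
  (* The product of [aa K i] and [aa K k] brings k into a coefficient; the zero index sum eliminates
     it. The 1 is the sum of the two halves dropped by [hfloor]. *)
  have -> : k%:~R = - (j%:~R + i%:~R + 1) :> K.
    by rewrite -[LHS]subr0 -[0]/(0%:~R) -e0 !rmorphD /=; ring.
  rewrite -[1 *: _]/(1 * _); by field; rewrite nz2 nz4.
- rewrite -[<< k >>]/(aa K k) -[<< i >>]/(eps K i) -[<< j >>]/(aa K j).
  rewrite !(gZl, gZr) ge !ga.
  case: j k => [j] [k]; rewrite /hval /hadd /haddz /= !rmorphD /=.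
  have -> : i + (j + k + 1) = i + j + k + 1 by ring.
  have -> : j + (i + k) + 1 = i + j + k + 1 by ring.
  case: eqVneq => [e0|_]; last by rewrite !mulr0 scaler0 addr0.
  have -> : k%:~R = - (i%:~R + j%:~R + 1) :> K.
    by rewrite -[LHS]subr0 -[0]/(0%:~R) -e0 !rmorphD /=; ring.
  rewrite -[1 *: _]/(1 * _); by field; rewrite nz2 nz4.
(* All structure constants are 1 here, leaving -(i + j) = -j - i. *)
- rewrite -[<< k >>]/(eps K k) -[<< i >>]/(eps K i) -[<< j >>]/(eps K j).
  rewrite !ge (addrCA j) !(addrA i) !mul1r scale1r rmorphD /= opprD mulrDl.
  exact: addrC.
Qed.

End Gamma.

Theorem theorem2 (K : fieldType) (charK0 : [pchar K] =i pred0) :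
  [/\ forall n : int, gamma K false (eps K n) = - n%:~R *: eps_dual K (- n),
      forall i : halfint,
        gamma K true (aa K i) = (hval i ^+ 2 - 4^-1) *: aa_dual K (hopp i),
      is_cocycle 1 (cochain1 (gamma K)) &
      ~ is_coboundary 1 (cochain1 (gamma K))].
Proof.
split; [exact: gamma_epsE | exact: gamma_aaE | |].
  apply: derivation_cocycle; last exact: gamma_derivation.
  by rewrite ((pcharf0P K).1 charK0).
(* The image of [eps K 1] takes the value -1 on [eps K (-1)]; the second family is indexed by the
   empty ['I_0]. *)
move=> /coboundary1_eq0/(_ 1 0 (fun=> eps K 1) (fun=> 0)) gamma0.
have := gamma_eps_pairing K 1 (-1); rewrite [gamma _ _ _]gamma0.
rewrite subrr eqxx mulr1 => /eqP; by rewrite eq_sym oppr_eq0 oner_eq0.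
Qed.
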